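(* For an integer $n\ge 1$ let $L_n$ be the set of all subsets of $[n]=\{1,2,\ldots,n\}$ that are arithmetic progressions, partially ordered by inclusion, and let $L_0=\{\emptyset\}$. Let $\mu_n$ denote the Möbius function of $L_n$ and write $\mu_n(L_n)=\mu_n(\emptyset,[n])$ (with $\mu_0(L_0)=\mu_0(\emptyset,\emptyset)$). Then $\mu_0(L_0)=1$, $\mu_1(L_1)=-1$, and $\mu_n(L_n)=\mu(n-1)$ for all $n\ge 2$, where $\mu$ is the classical number-theoretic Möbius function.
   Context: An arithmetic progression in $[n]$ is a set of the form $\{a,a+r,\ldots,a+(k-1)r\}\subseteq[n]$ with integers $a$, $r\ge 1$, $k\ge 0$; this includes the empty set, all singletons and all $2$-element subsets. $L_n$ is a lattice with minimum $\emptyset$, maximum $[n]$, and meet given by intersection. The Möbius function of a finite poset $X$ is defined on pairs $x\le y$ by $\mu_X(x,x)=1$ and $\mu_X(x,y)=-\sum_{x\le z<y}\mu_X(x,z)$ for $x<y$. The classical Möbius function: $\mu(1)=1$, $\mu(s)=(-1)^j$ if $s$ is a product of $j$ distinct primes, and $\mu(s)=0$ if $s$ is divisible by the square of a prime. *)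

(* Defs.v *)
From HB Require Import structures.
From mathcomp Require Import all_boot all_order all_algebra zify.
From mathcomp Require Import boolp.

Set Implicit Arguments.
Unset Strict Implicit.
Unset Printing Implicit Defensive.

Import Order.TTheory GRing.Theory Num.Theory.

Local Open Scope ring_scope.

Section PosetMobius.
Context {d : Order.disp_t} {T : finPOrderType d}.
Implicit Types x y z : T.

(* Recursion on fuel; #|T| is enough fuel by [mobius_lt]. Incomparable pairs
   get the value 0, since the sum is then empty. *)
Fixpoint mobius_rec (fuel : nat) x y : int :=
  if x == y then 1 else
  if fuel is m.+1 then - \sum_(z : T | (x <= z < y)%O) mobius_rec m x z else 0.

Definition mobius x y : int := mobius_rec #|T| x y.

Lemma mobius_refl x : mobius x x = 1.
Proof. by rewrite /mobius; case: #|T| => [|m] /=; rewrite eqxx. Qed.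

Lemma mobius_rec_fuel m m' x y :
  (#|[set z | (z < y)%O]| <= m)%N -> (#|[set z | (z < y)%O]| <= m')%N ->
  mobius_rec m x y = mobius_rec m' x y.
Proof.
have card0 u v : (#|[set z | (z < v)%O]| <= 0)%N ->
    - \sum_(z : T | (u <= z < v)%O) mobius_rec 0 u z = 0
    /\ forall k, - \sum_(z : T | (u <= z < v)%O) mobius_rec k u z = 0.
  rewrite leqn0 cards_eq0 => /eqP e0.
  suff H k : - \sum_(z : T | (u <= z < v)%O) mobius_rec k u z = 0 by split.
  rewrite big_pred0 ?oppr0 // => z; apply/negP => /andP[_ ltzv].
  by have := in_set0 z; rewrite -e0 inE ltzv.
elim: m m' y => [|m IH] [|m'] y //= hm hm'; case: eqP => // _.
- by rewrite (card0 x y hm).2.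
- by rewrite (card0 x y hm').2.
congr (- _); apply: eq_bigr => z /andP[_ ltzy].
have sub : (#|[set w | (w < z)%O]| < #|[set w | (w < y)%O]|)%N.
  apply: proper_card; apply/properP; split.
    by apply/subsetP => w; rewrite !inE => /lt_trans; apply.
  by exists z; rewrite !inE ?ltxx.
by apply: IH; rewrite -ltnS; apply: leq_trans sub _.
Qed.

Lemma mobius_lt x y : (x < y)%O ->
  mobius x y = - \sum_(z : T | (x <= z < y)%O) mobius x z.
Proof.
move=> ltxy; rewrite /mobius.
have -> : mobius_rec #|T| x y = mobius_rec #|T|.+1 x y.
  by apply: mobius_rec_fuel; [|apply: leqW]; apply: max_card.
by rewrite /= (lt_eqF ltxy).
Qed.

End PosetMobius.

(* [i : 'I_n] stands for the element i + 1 of [n] = {1, ..., n}. *)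
Definition is_ap (n : nat) (A : {set 'I_n}) : Prop :=
  exists (a : int) (r k : nat),
    [/\ (1 <= r)%N,
        forall j : nat, (j < k)%N -> 1 <= a + (j * r)%:Z <= n%:Z
      & forall i : 'I_n,
          i \in A <-> exists2 j : nat, (j < k)%N & i.+1%:Z = a + (j * r)%:Z].

Record APset (n : nat) : predArgType :=
  MkAPset { ap_val :> {set 'I_n}; _ : `[< is_ap ap_val >] }.

HB.instance Definition _ n := [isSub for @ap_val n].
HB.instance Definition _ n := [Finite of APset n by <:].

Section APsetOrder.
Variable n : nat.

Definition ap_le (A B : APset n) : bool := ap_val A \subset ap_val B.

Fact ap_le_refl : reflexive ap_le.
Proof. by move=> A; apply: subxx. Qed.

Fact ap_le_anti : antisymmetric ap_le.
Proof. by move=> A B AB; apply/val_inj/eqP; rewrite eqEsubset. Qed.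

Fact ap_le_trans : transitive ap_le.
Proof. by move=> B A C; apply: subset_trans. Qed.

End APsetOrder.

Fact ap_display : Order.disp_t. Proof. exact: Order.Disp tt tt. Qed.

HB.instance Definition _ n := Order.Le_isPOrder.Build ap_display (APset n)
  (@ap_le_refl n) (@ap_le_anti n) (@ap_le_trans n).

Fact is_ap_set0 n : `[< is_ap (set0 : {set 'I_n}) >].
Proof.
apply/asboolP; exists 0, 1%N, 0%N; split=> // i.
by rewrite inE; split=> // -[].
Qed.

Fact is_ap_setT n : `[< is_ap [set: 'I_n] >].
Proof.
apply/asboolP; exists 1, 1%N, n; split=> // [j|i]; first lia.
by rewrite inE; split=> // _; exists (i : nat); [exact: ltn_ord | lia].
Qed.

Definition ap_empty n : APset n := MkAPset (is_ap_set0 n).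
Definition ap_full n : APset n := MkAPset (is_ap_setT n).

(* The value at s = 0 is irrelevant. *)
Definition nt_mobius (s : nat) : int :=
  if has (fun p => p ^ 2 %| s)%N (primes s) then 0 else (-1) ^+ size (primes s).

(* Main.v *)
(* By induction on #|z|, the Moebius value at an arithmetic progression z depends
   only on #|z|: it is 1, -1 for sizes 0, 1 and mu(k - 1) for size k >= 2. One has
   to see that these values sum to 0 over the progressions contained in a given
   nonempty progression A, of difference r. A nonempty one is determined by its
   endpoints x <= y and its number e of steps; if x < y, then e ranges over the
   divisors of (y - x) / r, so that these progressions contribute
   sum_(e | (y - x) / r) mu(e), which is 1 if y = x + r and 0 otherwise. The
   total is therefore 1 - #|A| + (#|A| - 1) = 0. *)
Require Import Defs.
From mathcomp Require Import all_boot all_order all_algebra zify boolp.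

Set Implicit Arguments.
Unset Strict Implicit.
Unset Printing Implicit Defensive.

Import Order.TTheory GRing.Theory Num.Theory.

Local Open Scope ring_scope.

(** * Divisor sums of the classical Möbius function *)

(** The prime list gains exactly [p], which flips the sign. No new square appears: [p] divides
    [p * e] only once, and the square of any other prime is coprime to [p]. *)
Lemma nt_mobius_mul_prime p e : prime p -> (0 < e)%N -> ~~ (p %| e)%N ->
  nt_mobius (p * e) = - nt_mobius e.
Proof.
move=> pp e0 npe; have p0 := prime_gt0 pp.
have peP q : (q \in primes (p * e)) = (q \in p :: primes e).
  by rewrite primesM // primes_prime // !inE.
have pN : p \notin primes e by rewrite mem_primes pp e0.
have perm : perm_eq (primes (p * e)) (p :: primes e).
  by apply: uniq_perm => //=; rewrite ?pN primes_uniq.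
rewrite /nt_mobius (perm_size perm) (perm_has _ perm) /=.
have -> : (p ^ 2 %| p * e)%N = false.
  by rewrite expnS expn1 dvdn_pmul2l // (negbTE npe).
rewrite /=.
have -> : has (fun q => q ^ 2 %| p * e)%N (primes e)
        = has (fun q => q ^ 2 %| e)%N (primes e).
  apply: eq_in_has => q; rewrite mem_primes => /and3P[pq _ qe].
  rewrite Gauss_dvdr // coprimeXl // prime_coprime // dvdn_prime2 //.
  by apply: contraNN npe => /eqP <-.
by case: ifP; rewrite ?oppr0 // exprS mulN1r.
Qed.

Lemma nt_mobius_sqr p e : prime p -> (0 < e)%N -> (p ^ 2 %| e)%N ->
  nt_mobius e = 0.
Proof.
move=> pp e0 p2e; rewrite /nt_mobius; case: hasP => // -[]; exists p => //.
by rewrite mem_primes pp e0 (dvdn_trans _ p2e) // expnS dvdn_mulr.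
Qed.

(* For a prime divisor p of m, the terms with e prime to p cancel against
   those of the form p * e, and the multiples of p ^ 2 contribute nothing. *)
Lemma sum_divisors_nt_mobius m : (0 < m)%N ->
  \sum_(e <- divisors m) nt_mobius e = (m == 1%N)%:R.
Proof.
move=> m0; case: eqVneq => [->|m1]; first by rewrite big_seq1.
have pp : prime (pdiv m) by rewrite pdiv_prime // ltn_neqAle eq_sym m1.
move: (pdiv m) pp (pdiv_dvd m) => p pp pm.
have p0 := prime_gt0 pp.
rewrite (bigID (fun e => p %| e)%N) /= (bigID (fun e => p ^ 2 %| e)%N) /=.
rewrite big1_seq ?add0r => [|e /andP[/andP[_ p2e]]]; last first.
  by rewrite -dvdn_divisors // => /(dvdn_gt0 m0) e0; apply: nt_mobius_sqr p2e.
rewrite -big_filter -[X in _ + X]big_filter.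
set s := filter _ _; set t := filter _ _.
have st : perm_eq s (map (muln p) t).
  apply: uniq_perm; first by rewrite filter_uniq ?divisors_uniq.
    rewrite map_inj_uniq ?filter_uniq ?divisors_uniq // => u v /eqP.
    by rewrite eqn_pmul2l // => /eqP.
  move=> e; rewrite mem_filter -dvdn_divisors //.
  apply/idP/mapP => [/andP[/andP[/dvdnP[q ->]]]|[q + ->]].
    rewrite expnS expn1 dvdn_pmul2r // => pq qpm.
    exists q; last by rewrite mulnC.
    by rewrite mem_filter pq -dvdn_divisors // (dvdn_trans _ qpm) ?dvdn_mulr.
  rewrite mem_filter -dvdn_divisors // => /andP[pq qm].
  rewrite dvdn_mulr //= expnS expn1 dvdn_pmul2l // pq /=.
  by rewrite Gauss_dvd ?pm // prime_coprime.
rewrite (perm_big _ st) big_map -big_split /= big1_seq // => e.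
rewrite mem_filter -dvdn_divisors // => /and3P[_ pe em].
by rewrite nt_mobius_mul_prime ?addNr // (dvdn_gt0 m0 em).
Qed.

(** Recasts the divisor sum over ordinals, the form in which step counts occur below. The bound [N]
    loses no divisor, and 0 does not divide the positive [m]. *)
Lemma sum_dvdn_nt_mobius N m : (0 < m < N)%N ->
  \sum_(e < N | (e %| m)%N) nt_mobius e = (m == 1%N)%:R.
Proof.
move=> /andP[m0 mN]; rewrite -sum_divisors_nt_mobius //.
rewrite -(big_mkord (fun e => e %| m)%N) -big_filter; apply: perm_big.
apply: uniq_perm; rewrite ?filter_uniq ?iota_uniq ?divisors_uniq // => e.
rewrite mem_filter mem_index_iota -dvdn_divisors //=.
by case: (boolP (e %| m)%N) => //= /(dvdn_leq m0) em; lia.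
Qed.

(** * Progressions given by start, difference and number of steps *)

(** Here [a] is 0-based, as in ['I_n], and [l] counts steps, so there are [l.+1] terms. Terms
    outside ['I_n] are dropped, whence the bound [a + l * r < n] in the lemmas. *)
Definition prog n (a r l : nat) : {set 'I_n} :=
  [set i : 'I_n | [exists t : 'I_l.+1, i == a + t * r :> nat]%N].

Lemma progP n a r l (i : 'I_n) :
  reflect (exists2 t, (t <= l)%N & i = (a + t * r)%N :> nat) (i \in prog n a r l).
Proof.
rewrite inE; apply: (iffP existsP) => [[t /eqP ->]|[t tl e]].
  by exists t => //; rewrite -ltnS.
by exists (Ordinal (tl : (t < l.+1)%N)); apply/eqP.
Qed.

Lemma is_ap_prog n a r l : (0 < r)%N -> (a + l * r < n)%N -> is_ap (prog n a r l).
Proof.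
move=> r0 ln; exists a.+1%:Z, r, l.+1; split=> // [j|i].
  by rewrite ltnS => jl; have := leq_mul jl (leqnn r); lia.
split=> [/progP[t tl e]|[t tl e]]; first by exists t => //; lia.
by apply/progP; exists t => //; lia.
Qed.

Lemma is_apP n (A : {set 'I_n}) : is_ap A -> A != set0 ->
  exists a r l, [/\ (0 < r)%N, (a + l * r < n)%N & A = prog n a r l].
Proof.
case=> a [r [k [r0 ak Ak]]] /set0Pn[x /Ak[j jk _]].
case: k => // l in ak Ak jk *.
have := ak 0%N isT; have := ak l (leqnn _) => al a1.
(* The bound at index 0 gives [1 <= a], so this is [a - 1], the 0-based start. *)
exists (`|a|.-1)%N, r, l; split=> //; first lia.
apply/setP => i; apply/idP/progP => [/Ak[t tl e]|[t tl e]].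
  by exists t => //; lia.
by apply/Ak; exists t => //; lia.
Qed.

(** The alternative [l == 0] admits the step 0 that [span_prog] assigns to singletons. *)
Lemma card_prog n a r l : (0 < r)%N || (l == 0)%N -> (a + l * r < n)%N ->
  #|prog n a r l| = l.+1.
Proof.
move=> rl ln.
have tn (t : 'I_l.+1) : (a + t * r < n)%N.
  have tl : (t <= l)%N by rewrite -ltnS.
  by have := leq_mul tl (leqnn r); lia.
have -> : prog n a r l = [set Ordinal (tn t) | t : 'I_l.+1].
  apply/setP => i; rewrite inE; apply/existsP/imsetP => -[t].
    by move/eqP => e; exists t => //; apply: val_inj.
  by move=> _ ->; exists t.
rewrite card_imset ?card_ord // => t u [] /eqP.
rewrite eqn_add2l eqn_mul2r => /orP[/eqP r0|/eqP/val_inj //].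
by apply: val_inj; move: rl (ltn_ord t) (ltn_ord u) => /=; lia.
Qed.

(* The triple (minimum, maximum, number of steps) of a nonempty progression
   contained in the progression A of difference r. For e = 0 the last condition
   reads y = x, and the step (y - x) %/ e of [span_prog] is the junk value 0. *)
Definition spans n (A : {set 'I_n}) (r : nat) (u : 'I_n * 'I_n * 'I_n) : bool :=
  let: (x, y, e) := u in
  [&& x \in A, y \in A, (x <= y)%N, (e == 0 :> nat)%N == (x == y)
    & (e * r %| y - x)%N].

Definition span_prog n (u : 'I_n * 'I_n * 'I_n) : {set 'I_n} :=
  let: (x, y, e) := u in prog n x ((y - x) %/ e) e.

(** * Nonempty progressions inside a fixed progression *)

Section Spans.
Variables (n a r l : nat).
Hypotheses (r0 : (0 < r)%N) (ln : (a + l * r < n)%N).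
Let A := prog n a r l.

Lemma spans_mul x y e : spans A r (x, y, e) -> (e * ((y - x) %/ e) = y - x)%N.
Proof.
case/and5P=> _ _ xy exy er; rewrite mulnC divnK //.
by apply: dvdn_trans er; apply: dvdn_mulr.
Qed.

Lemma spans_step x y e : spans A r (x, y, e) ->
  (0 < (y - x) %/ e)%N || (e == 0 :> nat)%N.
Proof.
move=> h; have := spans_mul h; case/and5P: h => _ _ xy /eqP exy er m.
have [->|e0] := posnP e; first by rewrite orbT.
rewrite lt0n; apply/orP; left; apply/eqP => q0; move: m; rewrite q0 muln0 => xy0.
suff /eqP : x = y by rewrite -exy; lia.
by apply: val_inj => /=; lia.
Qed.

Lemma spans_last x y e : spans A r (x, y, e) -> (x + e * ((y - x) %/ e) = y)%N.
Proof. by move=> h; rewrite (spans_mul h) subnKC //; case/and5P: h. Qed.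

Lemma card_span_prog x y e : spans A r (x, y, e) -> #|span_prog (x, y, e)| = e.+1.
Proof.
move=> h; apply: card_prog; first exact: spans_step h.
by rewrite (spans_last h).
Qed.

Lemma is_ap_span_prog u : spans A r u -> is_ap (span_prog u).
Proof.
case: u => -[x y] e h; rewrite /span_prog.
case/orP: (spans_step h) => [q0|/eqP e0].
  by apply: is_ap_prog => //; rewrite (spans_last h).
(* A singleton has the junk step 0, but [is_ap] asks for a positive one; any step gives the same
   set. *)
have -> : prog n x ((y - x) %/ e) e = prog n x 1 0.
  apply/setP => i; rewrite e0.
  by apply/progP/progP => -[t]; rewrite leqn0 => /eqP -> ->; exists 0%N.
by apply: is_ap_prog => //; rewrite mul0n addn0.
Qed.

Lemma span_prog_sub u : spans A r u -> span_prog u \subset A.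
Proof.
case: u => -[x y] e h; apply/subsetP => i /progP[t te ie].
have m := spans_mul h; have := spans_last h; move: h m.
case/and5P=> /progP[ix ixl xE] /progP[iy iyl yE] xy _ er m lst.
have [e0|e0] := posnP e.
  by apply/progP; exists ix => //; rewrite ie xE; move: te; rewrite e0; lia.
(* Cancelling [e] in [e * r %| y - x] makes the step a multiple of [r], so every term stays on the
   grid of [A], between [x] and [y]. *)
have /dvdnP[c cE] : (r %| (y - x) %/ e)%N.
  by rewrite -(@dvdn_pmul2l e) // m.
apply/progP; exists (ix + t * c)%N; last by rewrite ie cE xE mulnDl mulnA addnA.
suff: ((ix + t * c) * r <= iy * r)%N by rewrite leq_pmul2r //; lia.
have := leq_mul te (leqnn (c * r)); rewrite -cE.
by move: ie; rewrite cE; nia.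
Qed.

(** The set determines its triple: [x] is its minimum, [y] its maximum, and [e.+1] its
    cardinality. *)
Lemma span_prog_inj : {in [set u | spans A r u] &, injective (@span_prog n)}.
Proof.
have first x y e : x \in span_prog (x, y, e) by apply/progP; exists 0%N; rewrite ?mul0n ?addn0.
have last x y e : spans A r (x, y, e) -> y \in span_prog (x, y, e).
  by move=> h; apply/progP; exists (e : nat) => //; rewrite (spans_last h).
have lb x y e (i : 'I_n) : i \in span_prog (x, y, e) -> (x <= i)%N.
  by case/progP=> t _ ->; apply: leq_addr.
have ub x y e (i : 'I_n) : spans A r (x, y, e) -> i \in span_prog (x, y, e) -> (i <= y)%N.
  move=> h /progP[t te ->]; rewrite -[X in (_ <= X)%N](spans_last h).
  by rewrite leq_add2l leq_mul.
move=> [[x y] e] [[x' y'] e']; rewrite !inE => h h' E.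
have ee : e = e'.
  by apply: val_inj; apply/eq_add_S; rewrite -(card_span_prog h) -(card_span_prog h') E.
have xx : x = x'.
  apply/val_inj/eqP; rewrite /= eqn_leq; apply/andP; split.
    by apply: (lb x y e); rewrite E; apply: first.
  by apply: (lb x' y' e'); rewrite -E; apply: first.
have yy : y = y'.
  apply/val_inj/eqP; rewrite /= eqn_leq; apply/andP; split.
    by apply: (ub x' y' e') => //; rewrite -E; apply: last.
  by apply: (ub x y e) => //; rewrite E; apply: last.
by congr (_, _, _).
Qed.

Lemma sub_ap_spans (B : {set 'I_n}) : is_ap B -> B != set0 -> B \subset A ->
  exists2 u, spans A r u & B = span_prog u.
Proof.
move=> apB B0 /subsetP BA; have [b [s [e [s0 en BE]]]] := is_apP apB B0.
have bn : (b < n)%N by lia.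
have een : (e < n)%N by nia.
pose x := Ordinal bn; pose y := Ordinal en; pose e' := Ordinal een.
have xB : x \in B by rewrite BE; apply/progP; exists 0%N => //=; lia.
have yB : y \in B by rewrite BE; apply/progP; exists e.
have yx : (y - x = e * s)%N by rewrite /=; lia.
exists (x, y, e'); last first.
  rewrite BE /span_prog yx /=; case: (posnP e) => [->|e0].
    by apply/setP => i; apply/progP/progP => -[t]; rewrite leqn0 => /eqP -> ->; exists 0%N.
  by rewrite mulKn.
rewrite /spans !BA // yx /=; apply/and3P; split; first lia.
  by rewrite -val_eqE /=; apply/eqP; apply/eqP/eqP; nia.
have [->|e0] := posnP e; first by rewrite !mul0n.
rewrite dvdn_pmul2l //.
(* As [e > 0], the second term [b + s] of [B] lies in [A] along with [b], so their difference [s] is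
   a multiple of [r]. *)
have zn : (b + s < n)%N by nia.
have /BA/progP[j jl jE] : Ordinal zn \in B.
  by rewrite BE; apply/progP; exists 1%N => //=; lia.
have /progP[i il iE] := BA _ xB.
by apply/dvdnP; exists (j - i)%N; move: iE jE => /=; nia.
Qed.

Lemma sum_spans (F : nat -> int) :
  \sum_(z : APset n | (ap_val z != set0) && (ap_val z \subset A)) F #|ap_val z| =
  \sum_(u | spans A r u) F u.2.+1.
Proof.
pose D := [set z : APset n | (ap_val z != set0) && (ap_val z \subset A)].
transitivity (\sum_(z in D) F #|ap_val z|).
  by apply: eq_bigl => z; rewrite inE.
rewrite -(big_imset (fun B : {set 'I_n} => F #|B|)) => [|z w _ _ /val_inj //].
have -> : [set ap_val z | z in D] = [set span_prog u | u in [set u | spans A r u]].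
  apply/setP => B; apply/imsetP/imsetP => [[z]|[u]]; rewrite inE.
    case: z => z zap /= /andP[z0 zA] ->.
    by have [u su ->] := sub_ap_spans (asboolW zap) z0 zA; exists u; rewrite ?inE.
  move=> su ->; exists (MkAPset (asboolT (is_ap_span_prog su))) => //.
  rewrite inE /= span_prog_sub // andbT -card_gt0.
  by case: u su => -[x y] e su; rewrite (card_span_prog su).
rewrite big_imset /=; last exact: span_prog_inj.
apply: eq_big => [u|[[x y] e]]; rewrite inE // => su.
by rewrite (card_span_prog su).
Qed.

(** * The candidate values and their vanishing sums *)

Definition ap_mobius (k : nat) : int :=
  match k with 0 => 1 | 1 => -1 | m.+1 => nt_mobius m end.

Lemma sum_ap_mobius_endpoints (x y : 'I_n) : x \in A -> y \in A ->
  \sum_(e < n | spans A r (x, y, e)) ap_mobius e.+1 =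
  (y == x + r :> nat)%N%:R - (x == y)%:R.
Proof.
move=> xA yA; rewrite /spans xA yA /=.
have [yx|yx] := ltnP y x.
  rewrite big_pred0 //.
  by rewrite -val_eqE (gtn_eqF yx); case: eqP => //; lia.
(* Equal endpoints force [e = 0]: the only term is the singleton value -1. *)
have [xy|xy] := eqVneq x y.
  have e0 : (0 < n)%N by lia.
  rewrite (big_pred1 (Ordinal e0)) => [|e]; last first.
    by rewrite xy subnn dvdn0 andbT eqb_id.
  by rewrite /= -xy; case: eqP => //; lia.
have {xy}yx : (x < y)%N by rewrite ltn_neqAle yx andbT.
rewrite subr0.
case/progP: xA => i il xE; case/progP: yA => j jl yE.
have ij : (i < j)%N by nia.
have yxE : (y - x = (j - i) * r)%N by nia.
transitivity (\sum_(e < n | (e %| j - i)%N) nt_mobius e).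
  apply: eq_big => [e|e].
    rewrite yxE dvdn_pmul2r //; case: (posnP e) => [->|//].
    by rewrite dvd0n; lia.
  by move=> /and3P[]; case: e => -[|[|e]].
rewrite sum_dvdn_nt_mobius; last by apply/andP; split; nia.
congr (nat_of_bool _)%:R; apply/eqP/eqP; nia.
Qed.

Lemma sum_sub_ap_mobius :
  \sum_(z : APset n | ap_val z \subset A) ap_mobius #|ap_val z| = 0.
Proof.
rewrite (bigD1 (ap_empty n)) /=; last exact: sub0set.
rewrite cards0 /= (eq_bigl (fun z : APset n => (ap_val z != set0) && (ap_val z \subset A))).
  2: by move=> z; rewrite andbC -val_eqE.
rewrite sum_spans.
have an : (a < n)%N by lia.
have aA : Ordinal an \in A by apply/progP; exists 0%N => //=; lia.
(* Grouped by the maximum [y], the inner sum is 1 - 1 = 0 when [y] has a predecessor [y - r] in [A].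
   The least element has none and gives -1, which cancels the 1 of the empty progression. *)
suff -> : \sum_(u | spans A r u) ap_mobius u.2.+1 = 
  \sum_(y in A) \sum_(x in A) ((y == x + r :> nat)%N%:R - (x == y)%:R : int).
  rewrite (bigD1 (Ordinal an)) //= [X in 1 + (_ + X)]big1 => [|y /andP[yA ya]].
    rewrite (bigD1 (Ordinal an)) //= eqxx big1 => [|x /andP[/progP[i _ xE] xa]].
      by case: eqP => //; lia.
    by rewrite (negbTE xa); case: eqP => //; lia.
  have /progP[[|j] jl yE] := yA.
    by case/eqP: ya; apply: val_inj; rewrite /= yE mul0n addn0.
  have zn : (a + j * r < n)%N by nia.
  rewrite sumrB (bigD1 (Ordinal zn)) /=; last by apply/progP; exists j => //; lia.
  rewrite big1 ?addr0 => [|x /andP[_ xz]]; last first.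
    by case: eqP => // yx; case/eqP: xz; apply: val_inj => /=; lia.
  rewrite (bigD1 y) //= eqxx big1 => [|x /andP[_ /negbTE -> //]].
  by case: eqP => //; lia.
rewrite exchange_big /=.
rewrite (eq_bigr (fun x => \sum_(y in A) \sum_(e < n | spans A r (x, y, e)) ap_mobius e.+1)).
  2: by move=> x xA; apply: eq_bigr => y yA; rewrite sum_ap_mobius_endpoints.
rewrite pair_big_dep pair_big_dep /=; apply: eq_big => [[[x y] e]|[[x y] e]] //=.
by case: (x \in A) => //=; case: (y \in A).
Qed.

End Spans.

Lemma mobius_ap n (z : APset n) : mobius (ap_empty n) z = ap_mobius #|ap_val z|.
Proof.
have [m] := ubnP #|ap_val z|; elim: m z => // m IH z zm.
have [z0|z0] := eqVneq z (ap_empty n); first by rewrite z0 mobius_refl /= cards0.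
have z0' : ap_val z != set0 by rewrite -[set0]/(ap_val (ap_empty n)) val_eqE.
have lez (w : APset n) : (ap_empty n <= w)%O by apply: sub0set.
rewrite mobius_lt ?lt_neqAle 1?eq_sym ?z0 ?lez //.
have zap : is_ap z by case: (z) => zs zp; apply: asboolW zp.
have [a [r [l [r0 ln zE]]]] := is_apP zap z0'.
(* Isolating the term of [z] in the vanishing sum yields the recursion that defines [mobius]; proper
   subsets are smaller, so the induction hypothesis covers the rest. *)
have := sum_sub_ap_mobius r0 ln; rewrite -zE (bigD1 z) //= => /eqP.
rewrite addr_eq0 => /eqP ->; congr (- _); apply: eq_big => [w|w].
  by rewrite lez lt_neqAle /= andbC.
case/andP=> _ wz; apply: IH; rewrite -ltnS; apply: leq_ltn_trans zm.
apply: proper_card; rewrite properEneq val_eqE; move: wz.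
by rewrite lt_neqAle.
Qed.

Theorem theorem1 :
  [/\ mobius (ap_empty 0) (ap_full 0) = 1,
      mobius (ap_empty 1) (ap_full 1) = -1
    & forall n : nat, (2 <= n)%N ->
        mobius (ap_empty n) (ap_full n) = nt_mobius (n - 1)].
Proof.
split=> [||[|[|n]] // _]; by rewrite mobius_ap /= cardsT card_ord //= subn1.
Qed.
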